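(* Suppose $S$ is a Seidel matrix with symmetric spectrum and exactly four distinct eigenvalues, which include $1$ and $-1$, both of multiplicity $1$. Then $S$ can be obtained from a symmetric conference matrix by deleting two rows and the corresponding columns.
   Context: A Seidel matrix is a real symmetric matrix with diagonal entries $0$ and all off-diagonal entries equal to $1$ or $-1$. The spectrum of a matrix is the multiset of its eigenvalues, counted with multiplicity; a real symmetric matrix with spectrum $\Sigma$ has symmetric spectrum if $\Sigma=-\Sigma$ as multisets. A conference matrix of order $n$ ($n\ge 2$) is an $n\times n$ matrix $C$ with diagonal entries $0$ and off-diagonal entries $\pm1$ satisfying $CC^\top=(n-1)I$. *)

(* Defs.v *)
From HB Require Import structures.
From mathcomp Require Import all_boot all_order all_algebra.
From mathcomp Require Import reals.
From mathcomp.real_closed Require Import complex.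

Set Implicit Arguments.
Unset Strict Implicit.
Unset Printing Implicit Defensive.

Import Order.TTheory GRing.Theory Num.Theory.
Local Open Scope ring_scope.

Definition zero_diag_pm1 (R : realType) (n : nat) (A : 'M[R]_n) : Prop :=
  (forall i, A i i = 0) /\ (forall i j, i != j -> A i j = 1 \/ A i j = -1).

Definition seidel (R : realType) (n : nat) (S : 'M[R]_n) : Prop :=
  S^T = S /\ zero_diag_pm1 S.

Definition conference (R : realType) (n : nat) (C : 'M[R]_n) : Prop :=
  [/\ (2 <= n)%N, zero_diag_pm1 C & C *m C^T = (n.-1)%:R%:M].

(* Multisets of reals are sequences up to [perm_eq].  [is_spectrum A s] says
   that [s] lists all roots of the characteristic polynomial with their
   multiplicities; for symmetric [A] such an [s] exists and is unique up to
   [perm_eq] (last and first lemmas below), and algebraic and geometric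
   multiplicities agree. *)
Definition is_spectrum (R : realType) (n : nat) (A : 'M[R]_n) (s : seq R) :
    Prop :=
  char_poly A = \prod_(a <- s) ('X - a%:P).

Definition symmetric_multiset (R : realType) (s : seq R) : Prop :=
  perm_eq s [seq - a | a <- s].

Definition delete_row_col (R : realType) (n : nat) (i : 'I_n.+1)
    (A : 'M[R]_n.+1) : 'M[R]_n :=
  row' i (col' i A).

Lemma is_spectrum_uniq (R : realType) (n : nat) (A : 'M[R]_n) (s t : seq R) :
  is_spectrum A s -> is_spectrum A t -> perm_eq s t.
Proof. by rewrite /is_spectrum => -> /prod_XsubC_eq. Qed.

Lemma char_poly_conjmx (F : fieldType) (n : nat) (P D : 'M[F]_n) :
  P \in unitmx -> char_poly (invmx P *m D *m P) = char_poly D.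
Proof.
move=> Pu; rewrite /char_poly /char_poly_mx !map_mxM /=.
have VP : map_mx polyC (invmx P) *m map_mx polyC P = 1%:M.
  by rewrite -map_mxM mulVmx // map_mx1.
have -> : 'X%:M - map_mx polyC (invmx P) *m map_mx polyC D *m map_mx polyC P
    = map_mx polyC (invmx P) *m ('X%:M - map_mx polyC D) *m map_mx polyC P.
  by rewrite mulmxBr mulmxBl -(mulmxA _ 'X%:M) -scalar_mxC mulmxA VP mul1mx.
by rewrite !det_mulmx mulrAC -det_mulmx VP det1 mul1r.
Qed.

Lemma is_spectrum_exists (R : realType) (n : nat) (A : 'M[R]_n) :
  A^T = A -> exists s, is_spectrum A s.
Proof.
move=> symA; pose f := real_complex R; pose B := map_mx f A.
have realB : B \is a realmx.
  by apply/mxOverP => i j; rewrite mxE; apply/complex_realP; exists (A i j).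
have hermB : B \is hermsymmx.
  apply: realsym_hermsym => //; apply/is_hermitianmxP.
  by rewrite expr0 scale1r map_mx_id // /B map_trmx symA.
have /hermitian_normalmx /orthomx_spectralP BE := hermB.
have realD := hermitian_spectral_diag_real hermB.
pose s := [seq complex.Re (spectral_diag B 0 i) | i <- enum 'I_n]; exists s.
apply: (map_poly_inj f); rewrite map_char_poly -/B {1}BE.
rewrite char_poly_conjmx ?spectral_unit // char_poly_trig ?diag_mx_is_trig //.
rewrite rmorph_prod /s big_map big_enum /=; apply: eq_bigr => i _.
rewrite mxE eqxx mulr1n rmorphB /= map_polyX map_polyC /=.
by rewrite /f RRe_real //; apply: (mxOverP realD).
Qed.

(* Main.v *)
Require Import Defs.
From mathcomp Require Import all_boot all_order all_algebra.
From mathcomp Require Import reals.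
From mathcomp.real_closed Require Import complex.
From mathcomp Require Import zify ring lra.
Import Order.TTheory GRing.Theory Num.Theory.
Local Open Scope ring_scope.

Set Implicit Arguments.
Unset Strict Implicit.
Unset Printing Implicit Defensive.

(** Let [M = (n + 1) I - S^2].  The spectrum is [1, -1] together with [t] and
    [- t], both of multiplicity [m], so that [n = 2 m + 2] is even; comparing
    [\tr (S^2) = n (n - 1)] with the sum of the squared eigenvalues gives
    [t^2 = n + 1].  Hence [M] kills the eigenvectors for [t] and [- t] and is
    [n] times the orthogonal projection onto the plane spanned by the
    eigenvectors for [1] and [-1] ([seidel_four_eigenvalues]).

    Everything is now a matter of integer matrices.  The diagonal of [M] is
    constantly [2] and [M] is positive semidefinite, so its entries are at most
    [2] in absolute value; a congruence modulo 4 among three rows of a [1, -1]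
    matrix ([dvdz4_triple]) shows that they are even.  Entries [2] and [-2]
    force two rows to be equal or opposite, and [M^2 = n M] makes each row have
    squared norm [2 n], hence exactly [n / 2] nonzero entries.  Therefore the rows form
    two classes of the same size and [M = 2 (p p^T + q q^T)], where [p] and [q]
    have entries [0, 1, -1] and complementary supports ([gram_split]).

    The plane spanned by [p] and [q] is invariant under [S], on which [S] is a
    symmetric integral involution of trace [0] (as [\tr (S^3) = 0]).  In the
    basis [p, q] its matrix is [[c, s], [s, - c]] with [c^2 + s^2 = 1].  The
    mod 4 congruence, applied to rows from both classes, shows that 4 divides
    [n]; and [c] is congruent to [n / 2 - 1] modulo 2, hence is odd.  So
    [c = 1] or [c = -1] and [s = 0].  This parity argument is what excludes the
    alternative in which [p] and [q] are swapped by [S].  Then [x = p + q] and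
    [y = p - q] are [1, -1] vectors with
    [S x = c y], [S y = c x], [x . y = 0] and [x x^T + y y^T = M]
    ([integer_extension]), which are precisely the conditions for bordering [S]
    by [x], [y] and the corner entry [- c] to give a conference matrix
    ([border_conference]). *)

(** * Traces and annihilating polynomials from the spectrum *)

(** A real symmetric matrix is unitarily diagonalizable over the complex
    numbers, where its diagonal form lists the given spectrum. *)
Lemma trace_horner_spectrum (R : realType) (n : nat) (A : 'M[R]_n.+1)
    (s : seq R) (g : {poly R}) :
  A^T = A -> is_spectrum A s -> \tr (horner_mx A g) = \sum_(a <- s) g.[a].
Proof.
move=> symA specA; pose f := real_complex R; pose B := map_mx f A.
have hermB : B \is hermsymmx.
  apply: realsym_hermsym.
    by apply/is_hermitianmxP; rewrite expr0 scale1r map_mx_id // map_trmx symA.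
  by apply/mxOverP => i j; rewrite mxE; apply/complex_realP; exists (A i j).
have /hermitian_normalmx /orthomx_spectralP BE := hermB.
set d := spectral_diag B in BE.
have Pu := spectral_unit B; set P := spectralmx B in BE Pu.
have ds : perm_eq (map f s) [seq d 0 i | i <- enum 'I_n.+1].
  apply: prod_XsubC_eq; rewrite 2!big_map big_enum /=.
  transitivity (char_poly B).
    rewrite -map_char_poly specA rmorph_prod /=.
    by apply: eq_bigr => a _; rewrite rmorphB /= map_polyX map_polyC.
  rewrite BE char_poly_conjmx // char_poly_trig ?diag_mx_is_trig //.
  by apply: eq_bigr => i _; rewrite mxE eqxx mulr1n.
apply: (fmorph_inj f); rewrite -trace_map_mx map_horner_mx -/B BE.
rewrite mxpoly.horner_mx_uconjC // -mulmxA mxtrace_mulC -mulmxA mulmxV // mulmx1.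
rewrite horner_mx_diag mxtrace_diag rmorph_sum /=.
under eq_bigr do rewrite mxE.
under [RHS]eq_bigr do rewrite -horner_map.
by rewrite -(big_enum _ _ _ (fun i => (map_poly f g).[d 0 i])) /=
  -[LHS](big_map (fun i => d 0 i) xpredT (fun z => (map_poly f g).[z]))
  -(perm_big _ ds) big_map.
Qed.

(** The trace of [N *m N] is the sum of the squared entries of [N]. *)
Lemma symmetric_sqr_trace_eq0 (R : realDomainType) (n : nat) (N : 'M[R]_n) :
  N^T = N -> \tr (N *m N) = 0 -> N = 0.
Proof.
move=> symN; have -> : \tr (N *m N) = \sum_i \sum_j N i j ^+ 2.
  apply: eq_bigr => i _; rewrite mxE; apply: eq_bigr => j _.
  by rewrite -{2}symN mxE expr2.
move=> /eqP tr0; apply/matrixP => i j; rewrite mxE; apply/eqP.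
move: tr0; rewrite psumr_eq0; last by move=> k _; apply: sumr_ge0 => l _; apply: sqr_ge0.
move=> /allP/(_ i); rewrite mem_index_enum => /(_ isT) /=.
rewrite psumr_eq0; last by move=> l _; apply: sqr_ge0.
by move=> /allP/(_ j); rewrite mem_index_enum => /(_ isT) /=; rewrite sqrf_eq0.
Qed.

Lemma horner_mx_sym (R : comNzRingType) (n : nat) (A : 'M[R]_n.+1) (g : {poly R}) :
  A^T = A -> (horner_mx A g)^T = horner_mx A g.
Proof.
move=> symA; elim/poly_ind: g => [|g c IH]; first by rewrite rmorph0 trmx0.
rewrite rmorphD rmorphM /= horner_mx_X horner_mx_C linearD /= tr_scalar_mx.
by rewrite trmx_mul IH symA -(comm_horner_mx _ (erefl (A *m A))).
Qed.

(** Diagonalizability enters only through traces: the symmetric matrix [g(A)]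
    has a square of trace zero. *)
Lemma horner_spectrum_eq0 (R : realType) (n : nat) (A : 'M[R]_n.+1)
    (s : seq R) (g : {poly R}) :
  A^T = A -> is_spectrum A s -> {in s, forall a, g.[a] = 0} ->
  horner_mx A g = 0.
Proof.
move=> symA specA g0; apply: symmetric_sqr_trace_eq0; first exact: horner_mx_sym.
have <- : horner_mx A (g * g) = horner_mx A g *m horner_mx A g by rewrite rmorphM.
rewrite (trace_horner_spectrum _ symA specA) big_seq big1 // => a /g0 ga.
by rewrite hornerM ga mul0r.
Qed.

(** * The spectrum and the identities it forces *)

(** Among four distinct values closed under negation and containing [1] and
    [-1] there must be a further nonzero one: [0] alone would make only three. *)
Lemma symmetric_spectrum_pm1 (R : realType) (s : seq R) :
  symmetric_multiset s -> size (undup s) = 4%N ->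
  count_mem 1 s = 1%N -> count_mem (-1) s = 1%N ->
  exists (t : R) (m : nat),
    (0 < m)%N /\ perm_eq s ([:: 1; -1] ++ nseq m t ++ nseq m (- t)).
Proof.
move=> sym s4 c1 cm1.
have cN a : count_mem (- a) s = count_mem a s.
  rewrite (permP sym (pred1 (- a))) count_map; apply: eq_count => x /=.
  by rewrite eqr_opp.
have inE a : (a \in undup s) = (0 < count_mem a s)%N.
  by rewrite mem_undup -has_pred1 has_count.
have inN a : (- a \in undup s) = (a \in undup s) by rewrite !inE cN.
have u := undup_uniq s.
have n11 : (1 : R) != -1 by rewrite -subr_eq0 opprK -mulr2n pnatr_eq0.
have [t [ts t0 t1 tm1]] : exists t, [/\ t \in undup s, t != 0, t != 1 & t != -1].
  have [/hasP[t ts]|/hasPn no] :=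
    boolP (has [pred t | [&& t != 0, t != 1 & t != -1]] (undup s)).
    by move=> /and3P[]; exists t.
  suff /(uniq_leq_size u) : {subset undup s <= [:: 0; 1; -1]} by rewrite s4.
  by move=> a /no /=; rewrite !in_cons in_nil orbF !negb_and !negbK.
have tNt : t != - t.
  by rewrite -subr_eq0 opprK -mulr2n mulrn_eq0 /=.
have su : {subset [:: 1; -1; t; - t] <= undup s}.
  move=> a; rewrite !in_cons in_nil orbF => /or4P[] /eqP -> //.
  - by rewrite inE c1.
  - by rewrite inE cm1.
  - by rewrite inN.
have u4 : uniq [:: 1; -1; t; - t].
  rewrite /= !in_cons !in_nil !orbF !negb_or n11 tNt eqr_opp.
  by rewrite [1 == t]eq_sym [-1 == t]eq_sym t1 tm1 -[1]opprK eqr_opp eq_sym tm1.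
have [_ eqs] := uniq_min_size u4 su (eq_leq s4).
exists t, (count_mem t s); split; first by rewrite -inE.
rewrite perm_sym; apply/allP => a; rewrite mem_cat => ha.
have as4 : a \in [:: 1; -1; t; - t].
  move: ha; rewrite /= !in_cons !mem_cat !mem_nseq -(mem_undup s) -eqs !in_cons.
  by case: (a == 1); case: (a == -1); case: (a == t) => //=;
    case: (a == - t) => //=; rewrite ?andbF.
move: u4; rewrite /= !in_cons !in_nil !orbF !negb_or.
move=> /and4P[/and3P[a1 a2 a3] /andP[a4 a5] a6 _].
rewrite /= !count_cat !count_nseq /=.
have b := (negbTE a1, negbTE a2, negbTE a3, negbTE a4, negbTE a5, negbTE a6).
have b' := (eq_sym (-1) (1 : R), eq_sym t 1, eq_sym (- t) 1, eq_sym t (-1),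
  eq_sym (- t) (-1), eq_sym (- t) t).
move: as4; rewrite !in_cons in_nil orbF.
case/or4P => /eqP ->; rewrite ?c1 ?cm1 ?cN ?b' ?eqxx ?b.
all: by rewrite /= ?mul1n ?mul0n ?addn0.
Qed.

Lemma size_spectrum (R : realType) (n : nat) (A : 'M[R]_n) (s : seq R) :
  is_spectrum A s -> size s = n.
Proof.
by move=> specA; have := size_char_poly A; rewrite specA size_prod_XsubC => -[].
Qed.

Lemma pm1_sqr_diag (R : comNzRingType) (n : nat) (A : 'M[R]_n) i :
  A^T = A -> (forall i, A i i = 0) ->
  (forall i j, i != j -> A i j = 1 \/ A i j = -1) ->
  (A *m A) i i = n%:R - 1.
Proof.
move=> symA diagA pmA; rewrite mxE (eq_bigr (fun h => 1 - (h == i)%:R)).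
  rewrite sumrB sumr_const card_ord (bigD1 i) //= eqxx.
  by rewrite big1 => [|h /negbTE -> //]; rewrite addr0.
move=> h _; have [->|hi] := eqVneq h i; first by rewrite diagA mul0r subrr.
by rewrite -{1}symA mxE; case: (pmA _ _ hi) => ->; rewrite ?mulrNN mulr1 subr0.
Qed.

(** The matrix [M] is [n] times the projection onto the plane of the simple
    eigenvectors; here [M *m M = n%:R *: M] is the annihilating polynomial
    [(X^2 - 1) (X^2 - (n + 1))] evaluated at [S]. *)
Lemma seidel_four_eigenvalues (R : realType) (n : nat) (S : 'M[R]_n)
    (spec : seq R) :
  seidel S -> is_spectrum S spec -> symmetric_multiset spec ->
  size (undup spec) = 4%N -> count_mem 1 spec = 1%N ->
  count_mem (-1) spec = 1%N ->
  let M := n.+1%:R%:M - S *m S in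
  [/\ ~~ odd n, (2 < n)%N, M *m M = n%:R *: M & \tr (S *m S *m S) = 0].
Proof.
case: n S => [|n] S seidelS specS sym s4 c1 cm1 M.
  by move: (size_spectrum specS) c1; case: (spec).
have symS : S^T = S by case: seidelS.
have [t [m [m0 spE]]] := symmetric_spectrum_pm1 sym s4 c1 cm1.
have nE : n.+1 = m.*2.+2.
  by rewrite -(size_spectrum specS) (perm_size spE) !size_cat !size_nseq /=; lia.
have trE g : \tr (horner_mx S g) = g.[1] + g.[-1] + (g.[t] + g.[- t]) *+ m.
  rewrite (trace_horner_spectrum _ symS specS) (perm_big _ spE) /= !big_cons big_cat /=.
  by rewrite !big_nseq -!Monoid.iteropE -!addrA mulrnDl.
have tE : t ^+ 2 = n.+2%:R.
  have : \tr (S *m S) = n.+1%:R * (n.+1%:R - 1).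
    case: seidelS => _ [diagS pmS].
    rewrite /mxtrace (eq_bigr (fun=> n.+1%:R - 1)); last first.
      by move=> i _; apply: pm1_sqr_diag.
    by rewrite sumr_const card_ord -[LHS]mulr_natl.
  have -> : S *m S = horner_mx S ('X ^+ 2) by rewrite rmorphXn /= horner_mx_X expr2.
  rewrite trE !hornerXn expr1n !sqrrN expr1n -mulr_natr nE.
  have -> : m.*2.+2%:R = 2 * m%:R + 2 :> R by rewrite -addn2 natrD -mul2n natrM.
  have -> : m.*2.+3%:R = 2 * m%:R + 3 :> R by rewrite -addn3 natrD -mul2n natrM.
  have m_neq0 : m%:R != 0 :> R by rewrite pnatr_eq0 -lt0n.
  by move=> trS; apply: (mulfI m_neq0); lra.
have annS : horner_mx S (('X ^+ 2 - 1) * ('X ^+ 2 - n.+2%:R%:P)) = 0.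
  apply: (horner_spectrum_eq0 symS specS) => a.
  rewrite (perm_mem spE) !in_cons mem_cat !mem_nseq m0 /=.
  rewrite hornerM !hornerD !hornerN !hornerXn !hornerC.
  case/or4P => /eqP ->; rewrite ?sqrrN ?expr1n ?tE ?subrr ?mul0r ?mulr0 //.
split.
- by rewrite nE /= odd_double.
- by rewrite nE; lia.
- apply/eqP; rewrite -subr_eq0; apply/eqP.
  rewrite -[RHS]annS rmorphM !rmorphB /= rmorphXn /= rmorph1 horner_mx_X horner_mx_C.
  rewrite -mul_scalar_mx -mulmxBl expr2 -/(S *m S) -[M in _ *m M]opprK mulmxN -mulNmx.
  rewrite /M !opprB; congr (_ *m _).
  have -> : n.+2%:R%:M = n.+1%:R%:M + 1 :> 'M[R]_n.+1.
    by rewrite -[n.+2]addn1 natrD raddfD.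
  by rewrite opprD addrCA (addrA _%:M) subrr sub0r.
- have -> : S *m S *m S = horner_mx S ('X ^+ 3).
    by rewrite rmorphXn /= horner_mx_X exprSr expr2.
  have N3 a : (- a) ^+ 3 = - a ^+ 3 :> R by ring.
  by rewrite trE !hornerXn !N3 expr1n !subrr mul0rn addr0.
Qed.

(** * Integral multiples of projections with diagonal 2 *)

(** Summed over [h], the product [(U i h + U j h) * (U i h + U l h)] of two even
    numbers expands to the three inner products plus [U i h ^+ 2 = 1]. *)
Lemma dvdz4_triple (n : nat) (U : 'M[int]_n) (i j l : 'I_n) :
  U^T = U -> (forall a b, U a b = 1 \/ U a b = -1) ->
  (4 %| n%:Z + (U *m U) i j + (U *m U) i l + (U *m U) j l)%Z.
Proof.
move=> symU pmU; have Uc a b : U a b = U b a by rewrite -{1}symU mxE.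
have -> : n%:Z + (U *m U) i j + (U *m U) i l + (U *m U) j l =
    \sum_h (U i h + U j h) * (U i h + U l h).
  have -> : n%:Z = \sum_(h < n) 1 by rewrite sumr_const card_ord natz.
  rewrite !mxE -!big_split /=; apply: eq_bigr => h _.
  rewrite (Uc h j) (Uc h l).
  by case: (pmU i h) => ->; ring.
apply: rpred_sum => h _.
by case: (pmU i h) => ->; case: (pmU j h) => ->; case: (pmU l h) => ->.
Qed.

Section ProjectionGram.
Variables (n : nat) (M : 'M[int]_n).
Hypotheses (symM : M^T = M) (diagM : forall i, M i i = 2)
  (sqrM : M *m M = n%:R *: M) (evenM : forall i j, (2 %| M i j)%Z).

Let Mc i j : M i j = M j i. Proof. by rewrite -{1}symM mxE. Qed.

(** Since [M *m M = n%:R *: M], the rows of [M] have the entries of [n%:R *: M]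
    as inner products.  This one identity bounds the entries of [M], and shows
    in the equality case that rows coincide up to sign. *)
Lemma gram_row_dist (e : int) i j : e * e = 1 ->
  \sum_h (M i h - e * M j h) ^+ 2 = n%:R * (4 - 2 * e * M i j).
Proof.
move=> e1; have E a b : \sum_h M a h * M b h = n%:R * M a b.
  transitivity ((M *m M) a b); last by rewrite sqrM mxE.
  by rewrite mxE; apply: eq_bigr => h _; rewrite (Mc b).
transitivity (\sum_h M i h * M i h - 2 * e * (\sum_h M i h * M j h)
              + e * e * (\sum_h M j h * M j h)).
  rewrite !mulr_sumr -sumrB -big_split /=; apply: eq_bigr => h _; ring.
rewrite !E e1 !diagM; ring.
Qed.

Lemma gram_entry i j : [\/ M i j = 0, M i j = 2 | M i j = -2].
Proof.
have n0 : (0 < n)%N by case: (n) i => [[]|].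
have H e : e * e = 1 -> 0 <= n%:Z * (4 - 2 * e * M i j).
  by move=> e1; rewrite -[n%:Z]natz -(gram_row_dist _ _ e1);
    apply: sumr_ge0 => h _; apply: sqr_ge0.
have := H 1 (erefl _); have := H (-1) (erefl _); have := evenM i j.
rewrite !pmulr_rge0 // => d h1 h2.
have : [|| M i j == 0, M i j == 2 | M i j == -2] by lia.
by case/or3P => /eqP; [exact: Or31|exact: Or32|exact: Or33].
Qed.

Lemma gram_row_eq (e : int) i j h : e * e = 1 -> M i j = 2 * e ->
  M i h = e * M j h.
Proof.
move=> e1 Mij; apply/eqP; rewrite -subr_eq0 -sqrf_eq0.
have /eqP := gram_row_dist i j e1.
rewrite Mij (_ : 4 - _ = 0) ?mulr0; last by rewrite -mulrA [e * _]mulrC -mulrA e1.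
rewrite psumr_eq0; last by move=> *; apply: sqr_ge0.
by move/allP/(_ h); rewrite mem_index_enum => /(_ isT).
Qed.

(** The vectors [p] and [q] are half of row [i0] and half of any row [j0]
    orthogonal to it; such a row exists because row [i0] has only [n / 2]
    nonzero entries.  Rows [i0] and [j0] have disjoint supports of size [n / 2],
    so together they cover all indices, and each remaining row is equal or
    opposite to one of them. *)
Lemma gram_split (i0 : 'I_n) : exists (p q : 'cV[int]_n) (j0 : 'I_n),
  [/\ M = 2 *: (p *m p^T + q *m q^T),
      forall h, p h 0 ^+ 2 + q h 0 ^+ 2 = 1,
      2 * (\sum_h p h 0 ^+ 2) = n%:Z,
      (p i0 0 = 1 /\ q i0 0 = 0) & (p j0 0 = 0 /\ q j0 0 = 1)].
Proof.
have n0 : (0 < n)%N by case: (n) i0 => [[]|].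
pose r i : 'cV[int]_n := \col_h (M h i %/ 2)%Z.
have rE i h : M h i = 2 * r i h 0 by rewrite mxE mulrC divzK.
have r3 i h : [\/ r i h 0 = 0, r i h 0 = 1 | r i h 0 = -1].
  by have := rE i h; case: (gram_entry h i) => -> ?;
     [apply: Or31|apply: Or32|apply: Or33]; lia.
have rsum i : 2 * (\sum_h r i h 0 ^+ 2) = n%:Z.
  apply: (@mulfI _ 2) => //; transitivity ((M *m M) i i).
    rewrite mxE !mulr_sumr; apply: eq_bigr => h _; rewrite (Mc i) !rE; ring.
  by rewrite sqrM mxE diagM mulrC -[n%:Z]natz.
have sum1 : \sum_(h < n) (1 : int) = n%:Z by rewrite sumr_const card_ord natz.
have rows i h l : r i h 0 != 0 -> M h l = 2 * r i h 0 * r i l 0.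
  move=> nz; rewrite (@gram_row_eq (r i h 0) h i) //.
  - by rewrite (Mc i) rE; ring.
  - by case: (r3 i h) nz => ->.
have [j0 pj0] : exists j0, r i0 j0 0 = 0.
  have [/existsP[j /eqP] | /existsPn no] := boolP [exists j, r i0 j 0 == 0].
    by exists j.
  have := rsum i0; rewrite (eq_bigr (fun=> 1)); first by rewrite sum1; lia.
  by move=> h _; have := no h; case: (r3 i0 h) => ->.
have pq0 h : r i0 h 0 != 0 -> r j0 h 0 = 0.
  by move=> nz; have := rows i0 h j0 nz; rewrite rE pj0 mulr0; lia.
have le1 h : 0 <= 1 - (r i0 h 0 ^+ 2 + r j0 h 0 ^+ 2).
  have [e|/pq0 ->] := eqVneq (r i0 h 0) 0.
    by rewrite e; case: (r3 j0 h) => ->.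
  by case: (r3 i0 h) => ->.
have one h : r i0 h 0 ^+ 2 + r j0 h 0 ^+ 2 = 1.
  have /eqP : \sum_h (1 - (r i0 h 0 ^+ 2 + r j0 h 0 ^+ 2)) = 0.
    rewrite sumrB big_split /= sum1; move: (rsum i0) (rsum j0); lra.
  rewrite psumr_eq0; last by move=> *; apply: le1.
  by move/allP/(_ h); rewrite mem_index_enum => /(_ isT) /=; rewrite subr_eq0 => /eqP <-.
exists (r i0), (r j0), j0; split=> //.
- apply/matrixP => h l.
  rewrite 2!mxE [(_ *m _) h l]mxE [X in _ + X]mxE !big_ord1.
  rewrite [_^T _ _]mxE [X in _ + _ * X]mxE.
  have [e|nz] := eqVneq (r i0 h 0) 0.
    rewrite e mul0r add0r mulrA; apply: rows.
    by apply/eqP => e'; have := one h; rewrite e e'.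
  by rewrite (pq0 _ nz) mul0r addr0 mulrA; apply: rows.
- have e : r i0 i0 0 = 1 by have := rE i0 i0; rewrite diagM; lia.
  by split=> //; apply: pq0; rewrite e.
- by split=> //; have := rE j0 j0; rewrite diagM; lia.
Qed.
End ProjectionGram.

(** * The two border vectors of an integral Seidel matrix *)

Section IntegerSeidel.
Variables (n : nat) (T : 'M[int]_n).
Hypotheses (symT : T^T = T) (diagT : forall i, T i i = 0)
  (pmT : forall i j, i != j -> T i j = 1 \/ T i j = -1).
Let M := n.+1%:R%:M - T *m T.

Let symM : M^T = M.
Proof. by rewrite linearB /= tr_scalar_mx trmx_mul symT. Qed.

Let diagM i : M i i = 2.
Proof.
rewrite 2!mxE eqxx mulr1n mxE pm1_sqr_diag //.
by rewrite -[n.+1]addn1 natrD; ring.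
Qed.

(** The congruence [dvdz4_triple] needs entries [1, -1] everywhere, so it is
    applied to [T + 1%:M], whose square is [- M + 2 T + (n + 2)].  The last term
    accounts for the diagonal entry that occurs when [j = l]; that degenerate
    case yields the parity of [M]. *)
Lemma seidel_triple_mod4 i j l : i != j -> i != l ->
  (4 %| n%:Z - (M i j + M i l + M j l) + 2 * (T i j + T i l + T j l)
     + (j == l)%:R * (n%:Z + 2))%Z.
Proof.
move=> ij il; pose U := T + 1%:M.
have symU : U^T = U by rewrite linearD /= symT tr_scalar_mx.
have pmU a b : U a b = 1 \/ U a b = -1.
  rewrite !mxE; have [->|ab] := eqVneq a b; first by rewrite diagT; left.
  by rewrite addr0; apply: pmT.
have UE a b : (U *m U) a b = - M a b + 2 * T a b + (a == b)%:R * n.+2%:R.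
  have -> : U *m U = - M + 2 *: T + n.+2%:R%:M.
    rewrite mulmxDl !mulmxDr !mulmx1 !mul1mx opprB; set TT := T *m T.
    apply/matrixP => x y; rewrite !mxE -[n.+2]addn1 natrD.
    by case: (x == y); rewrite ?mulr1n ?mulr0n; ring.
  by rewrite !mxE; case: (a == b) => /=; rewrite ?mulr1n ?mulr0n; ring.
have := dvdz4_triple i j l symU pmU; rewrite !UE (negbTE ij) (negbTE il).
rewrite -[n.+2]addn2 natrD (natz n) /= mulr0n mul0r.
by case: eqP => [->|_]; rewrite ?diagM ?diagT /= ?mulr1n ?mulr0n; lia.
Qed.

(** The spectrum supplies these identities, through [seidel_four_eigenvalues]. *)
Hypotheses (even_n : ~~ odd n) (n3 : (2 < n)%N)
  (sqrM : M *m M = n%:R *: M) (tr3 : \tr (T *m T *m T) = 0).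

Let evenM i j : (2 %| M i j)%Z.
Proof.
have [->|ij] := eqVneq i j; first by rewrite diagM.
have := seidel_triple_mod4 ij ij; rewrite eqxx diagM diagT mul1r.
move: even_n; lia.
Qed.

Lemma integer_extension : exists (x y : 'cV[int]_n) (c : int),
  [/\ c = 1 \/ c = -1, (forall i, x i 0 = 1 \/ x i 0 = -1) /\
      (forall i, y i 0 = 1 \/ y i 0 = -1),
      T *m x = c *: y /\ T *m y = c *: x, y^T *m x = 0 &
      T *m T + x *m x^T + y *m y^T = n.+1%:R%:M].
Proof.
have [i0 _] : exists i0 : 'I_n, true by exists (Ordinal (ltnW (ltnW n3))).
have [p [q [j0 [ME pq1 pp [pi qi] [pj qj]]]]] :=
  gram_split symM diagM sqrM evenM i0.
have Tc a b : T a b = T b a by rewrite -{1}symT mxE.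
have p3 h : (p h 0 = 0 /\ (q h 0 = 1 \/ q h 0 = -1)) \/
            (q h 0 = 0 /\ (p h 0 = 1 \/ p h 0 = -1)) by have := pq1 h; nia.
have pq0 h : p h 0 * q h 0 = 0 by case: (p3 h) => -[-> _]; rewrite ?mulr0 ?mul0r.
have Mij a b : M a b = 2 * (p a 0 * p b 0 + q a 0 * q b 0).
  by rewrite ME !mxE !big_ord1 !mxE.
have [a aD] : {a | T *m p = a} by exists (T *m p).
have [b bD] : {b | T *m q = b} by exists (T *m q).
have TM : T *m M = 2 *: (a *m p^T + b *m q^T).
  by rewrite ME -scalemxAr mulmxDr !mulmxA aD bD.
have MT : M *m T = 2 *: (p *m a^T + q *m b^T).
  by rewrite ME -scalemxAl mulmxDl -aD -bD !trmx_mul symT !mulmxA.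
(* The matrices [T] and [M] commute; read at columns [i0] and [j0], where
   [(p, q)] is [(1, 0)] and [(0, 1)], this gives the action of [T] on [p, q]. *)
have comm h i : a h 0 * p i 0 + b h 0 * q i 0 = p h 0 * a i 0 + q h 0 * b i 0.
  apply: (@mulfI _ 2) => //.
  have : (T *m M) h i = (M *m T) h i.
    by congr ((_ : 'M__) h i); rewrite /M mulmxBl mulmxBr scalar_mxC mulmxA.
  by rewrite TM MT !mxE !big_ord1 !mxE.
set c := a i0 0; set s := a j0 0; set s' := b j0 0.
have bi : b i0 0 = s by have := comm i0 j0; rewrite pi qi pj qj -/s; lia.
have aE : a = c *: p + s *: q.
  apply/matrixP => h k; rewrite ord1 !mxE.
  by have := comm h i0; rewrite pi qi bi -/c; lra.
have bE : b = s *: p + s' *: q.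
  apply/matrixP => h k; rewrite ord1 !mxE.
  by have := comm h j0; rewrite pj qj -/s -/s'; lra.
(* [T] is an involution on the image of [M], since [T^2 M = (n + 1) M - M^2]. *)
have cs1 : c * c + s * s = 1.
  have TTM : T *m (T *m M) = M.
    have -> : T *m (T *m M) = n.+1%:R *: M - M *m M.
      by rewrite {3}/M mulmxBl mul_scalar_mx mulmxA opprB addrC subrK.
    by rewrite sqrM -scalerBl -natr1 addrC addKr scale1r.
  have := congr1 (fun A : 'M__ => A i0 i0) TTM.
  rewrite diagM TM -scalemxAr mulmxDr 2!mulmxA aE bE !mulmxDr -!scalemxAr aD bD.
  rewrite !mxE !big_ord1 !mxE pi qi bi -/c.
  by lra.
(* The trace of [T *m M] is [(n + 1) \tr T - \tr T^3 = 0], and it is also [n]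
   times the trace of [T] on the plane spanned by [p] and [q]. *)
have tr0 : c + s' = 0.
  have : \tr (T *m M) = 0.
    rewrite /M mulmxBr mul_mx_scalar linearB /= linearZ /= mulmxA tr3.
    by rewrite /mxtrace big1 ?mulr0 ?subr0.
  rewrite TM linearZ linearD /= ![\tr (_ *m _^T)]mxtrace_mulC aE bE.
  rewrite !mulmxDr -!scalemxAr.
  rewrite /mxtrace !big_ord1 !mxE.
  have qq : 2 * (\sum_h q h 0 ^+ 2) = n%:Z.
    have : \sum_h (p h 0 ^+ 2 + q h 0 ^+ 2) = n%:Z.
      by under eq_bigr do rewrite pq1; rewrite sumr_const card_ord natz.
    by rewrite big_split /=; move: pp; lra.
  have -> : \sum_j p^T 0 j * p j 0 = \sum_h p h 0 ^+ 2.
    by apply: eq_bigr => h _; rewrite mxE.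
  have -> : \sum_j q^T 0 j * q j 0 = \sum_h q h 0 ^+ 2.
    by apply: eq_bigr => h _; rewrite mxE.
  rewrite [\sum_j p^T 0 j * q j 0]big1 => [|h _]; last by rewrite mxE pq0.
  rewrite [\sum_j q^T 0 j * p j 0]big1 => [|h _]; last by rewrite mxE mulrC pq0.
  move: pp qq; set P := \sum_h _; set Q := \sum_h _ => pp qq; nia.
(* A third index [l] shares its class with exactly one of [i0] and [j0], so the
   three entries of [M] add up to 2 modulo 4, as does twice the sum of three odd
   entries of [T]. *)
have n4 : (4 %| n)%N.
  have ij : i0 != j0 by apply/eqP => e; move: pi; rewrite e pj.
  have [l lij] : exists l, l \notin [:: i0; j0].
    apply/existsP; rewrite -negb_forall; apply/negP => /forallP all.
    have := uniq_leq_size (enum_uniq 'I_n) (fun l _ => all l).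
    by rewrite -cardE card_ord leqNgt n3.
  move: lij; rewrite !in_cons in_nil orbF negb_or ![l == _]eq_sym => /andP[il jl].
  have := seidel_triple_mod4 ij il; rewrite (negbTE jl) mul0r addr0 !Mij pi qi pj qj.
  case: (pmT ij) => ->; case: (pmT il) => ->; case: (pmT jl) => ->;
     by case: (p3 l) => -[-> [] ->]; lia.
(* The entry [c] of [T *m p] at [i0] is a sum of [n / 2 - 1] signs: one for each
   element of the support of [p] other than [i0] itself. *)
have c_odd : ~~ (2 %| c)%Z.
  have : (2 %| \sum_h (T i0 h * p h 0 - p h 0 ^+ 2 + (h == i0)%:R))%Z.
    apply: rpred_sum => h _; have [->|hi] := eqVneq h i0.
      by rewrite diagT pi.
    have hi' : i0 != h by rewrite eq_sym.
    by case: (pmT hi') => ->;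
       case: (p3 h) => [[-> _]|[_ [] ->]].
  rewrite big_split sumrB /= [X in _ + X](bigD1 i0) //= eqxx.
  rewrite [X in _ + (_ + X)]big1 => [|h /negbTE -> //].
  have -> : \sum_h T i0 h * p h 0 = c by rewrite /c -aD mxE.
  move: pp n4; set P := \sum_h _; lia.
have s0 : s = 0 by nia.
have c1 : c = 1 \/ c = -1 by nia.
have s'E : s' = - c by lia.
exists (p + q), (p - q), c; split=> //.
- by split=> h; rewrite !mxE; case: (p3 h) => -[-> [] ->]; (by left) || (by right).
- rewrite mulmxDr mulmxBr ?aD ?bD aE bE s0 s'E !scale0r addr0 add0r.
  by rewrite scaleNr opprK scalerBr scalerDr.
- apply/matrixP => u v; rewrite !ord1 !mxE (eq_bigr (fun h => p h 0 ^+ 2 - q h 0 ^+ 2)).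
    have : \sum_h (p h 0 ^+ 2 + q h 0 ^+ 2) = n%:Z.
      by under eq_bigr do rewrite pq1; rewrite sumr_const card_ord natz.
    by rewrite big_split sumrB /=; move: pp; lra.
  by move=> h _; rewrite !mxE; have := pq0 h; lra.
- have -> : n.+1%:R%:M = T *m T + M by rewrite /M addrC subrK.
  rewrite -addrA ME; congr (_ + _); apply/matrixP => u v.
  by rewrite !mxE !big_ord1 !mxE; ring.
Qed.
End IntegerSeidel.

(** * Bordering a Seidel matrix to a conference matrix *)

(** The two rows and columns of the conference matrix are added one at a time,
    by two nested borders. *)
Definition border (R : Type) (n : nat) (d : R) (v : 'cV[R]_n) (A : 'M[R]_n) :
    'M[R]_n.+1 :=
  block_mx (const_mx d : 'M_1) v^T v A.

Lemma border_seidel (R : realType) (n : nat) (v : 'cV[R]_n) (A : 'M[R]_n) :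
  seidel A -> (forall i, v i 0 = 1 \/ v i 0 = -1) -> seidel (border 0 v A).
Proof.
move=> [symA [diagA pmA]] pmv; split; [|split].
- by rewrite /border (@tr_block_mx _ 1 n 1 n) trmx_const trmxK symA.
- move=> i; rewrite /border; case: (@splitP 1 n i) => k ik.
    have -> : i = lshift n k by apply: val_inj.
    by rewrite (@block_mxEul _ 1 n 1 n) mxE.
  have -> : i = rshift 1 k by apply: val_inj.
  by rewrite (@block_mxEdr _ 1 n 1 n).
- move=> i j; rewrite /border; case: (@splitP 1 n i) => k ik;
    case: (@splitP 1 n j) => l jl.
  + by move=> /eqP[]; apply: val_inj; rewrite /= ik jl !ord1.
  + have -> : i = lshift n k by apply: val_inj.
    have -> : j = rshift 1 l by apply: val_inj.
    by rewrite (@block_mxEur _ 1 n 1 n) mxE ord1.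
  + have -> : i = rshift 1 k by apply: val_inj.
    have -> : j = lshift n l by apply: val_inj.
    by rewrite (@block_mxEdl _ 1 n 1 n) ord1.
  + have -> : i = rshift 1 k by apply: val_inj.
    have -> : j = rshift 1 l by apply: val_inj.
    by rewrite (@block_mxEdr _ 1 n 1 n) (inj_eq (@rshift_inj 1 n)); apply: pmA.
Qed.

Lemma delete_border (R : realType) (n : nat) (d : R) (v : 'cV[R]_n) (A : 'M[R]_n) :
  delete_row_col ord0 (border d v A) = A.
Proof.
apply/matrixP => i j; rewrite /delete_row_col mxE mxE -!rshift1 /border.
exact: (@block_mxEdr _ 1 n 1 n).
Qed.

Lemma border_sqr (R : comNzRingType) (n : nat) (v : 'cV[R]_n) (A : 'M[R]_n) :
  A^T = A ->
  border 0 v A *m border 0 v A =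
    block_mx (v^T *m v) (A *m v)^T (A *m v) (v *m v^T + A *m A) :> 'M_(1 + n).
Proof.
move=> symA; rewrite /border (@mulmx_block _ 1 n 1 n 1 n).
have -> : const_mx 0 = 0 :> 'M[R]_1 by apply/matrixP => i j; rewrite !mxE.
by rewrite !mul0mx !mulmx0 !add0r trmx_mul symA.
Qed.

Lemma pm1_dot (R : comNzRingType) (n : nat) (v : 'cV[R]_n) :
  (forall i, v i 0 = 1 \/ v i 0 = -1) -> v^T *m v = n%:R%:M.
Proof.
move=> pmv; apply/matrixP => i j; rewrite !ord1 !mxE eqxx mulr1n.
rewrite (eq_bigr (fun=> 1)) => [|h _]; first by rewrite sumr_const card_ord.
by rewrite mxE; case: (pmv h) => ->; rewrite ?mulrNN mulr1.
Qed.

(** The inner products of the rows of [C] are those of [S], [x], [y]: row [x]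
    against the rows of [S] gives [S x - c y = 0], row [x] against row [y] gives
    [x . y = 0], and likewise with [x] and [y] exchanged. *)
Lemma border_conference (R : realType) (n : nat) (S : 'M[R]_n) (x y : 'cV[R]_n)
    (c : R) (C := border 0 (col_mx (const_mx (- c) : 'M_1) x : 'cV_n.+1) (border 0 y S)) :
  seidel S -> c = 1 \/ c = -1 ->
  (forall i, x i 0 = 1 \/ x i 0 = -1) -> (forall i, y i 0 = 1 \/ y i 0 = -1) ->
  S *m x = c *: y -> S *m y = c *: x -> y^T *m x = 0 ->
  S *m S + x *m x^T + y *m y^T = n.+1%:R%:M ->
  C^T = C /\ conference C.
Proof.
move=> seidelS c1 pmx pmy Sx Sy yx SS.
have symS : S^T = S by case: seidelS.
pose v : 'cV[R]_n.+1 := col_mx (const_mx (- c) : 'M_1) x.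
have pmv i : v i 0 = 1 \/ v i 0 = -1.
  rewrite /v; case: (@splitP 1 n i) => k ik.
    have -> : i = lshift n k by apply: val_inj.
    rewrite (@col_mxEu _ 1 n) mxE; case: c1 => ->; first by right.
    by rewrite opprK; left.
  have -> : i = rshift 1 k by apply: val_inj.
  by rewrite (@col_mxEd _ 1 n).
have seidelA := border_seidel seidelS pmy.
have [symC pmC] := border_seidel seidelA pmv.
split=> //; split=> //.
rewrite symC (border_sqr _ (proj1 seidelA)) pm1_dot // border_sqr //.
have cc : const_mx (- c) = (- c)%:M :> 'M[R]_1.
  by apply/matrixP => i j; rewrite !ord1 !mxE.
have -> : border 0 y S *m v = 0.
  rewrite /border /v (@mul_block_col _ 1 n 1 n) yx Sx cc !mul_mx_scalar !scaleNr addNr.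
  have -> : const_mx 0 = 0 :> 'M[R]_1 by apply/matrixP => i j; rewrite !mxE.
  by rewrite scaler0 oppr0 addr0 col_mx0.
rewrite trmx0 [RHS](@scalar_mx_block _ 1 n.+1).
congr (@block_mx _ 1 n.+1 1 n.+1 _ _ _ _).
rewrite /v (@tr_col_mx _ 1 n) (@mul_col_row _ 1 n 1 1 n) cc pm1_dot // Sy.
rewrite (@add_block_mx _ 1 n 1 n) [RHS](@scalar_mx_block _ 1 n).
rewrite tr_scalar_mx !mul_scalar_mx mul_mx_scalar linearZ /= !scaleNr !addNr.
congr (@block_mx _ 1 n 1 n _ _ _ _); last by rewrite -SS addrA addrC addrA.
rewrite scale_scalar_mx -raddfN -raddfD /= mulrN opprK -[n.+1]add1n natrD.
by case: c1 => ->; rewrite ?mulrNN mulr1.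
Qed.

(** * Symmetric spectrum with simple eigenvalues 1 and -1 *)

Theorem theorem3 (R : realType) (n : nat) (S : 'M[R]_n) (spec : seq R)
    (hS : seidel S)
    (hspec : is_spectrum S spec)
    (hsym : symmetric_multiset spec)
    (hfour : size (undup spec) = 4%N)
    (hone : count_mem 1 spec = 1%N)
    (hmone : count_mem (-1) spec = 1%N) :
  exists (C : 'M[R]_n.+2) (i : 'I_n.+2) (j : 'I_n.+1),
    [/\ C^T = C, conference C & S = delete_row_col j (delete_row_col i C)].
Proof.
have [symS [diagS pmS]] := hS.
have [even_n n3 sqrM tr3] := seidel_four_eigenvalues hS hspec hsym hfour hone hmone.
pose T : 'M[int]_n := \matrix_(i, j) (if i == j then 0 else if S i j == 1 then 1 else -1).
have ST : map_mx intr T = S.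
  apply/matrixP => i j; rewrite !mxE; have [->|/pmS[->|->]] := eqVneq i j.
  - by rewrite diagS.
  - by rewrite eqxx.
  - by rewrite eqNr oner_eq0 rmorphN1.
have intr_mx_inj k l : injective (map_mx intr : 'M[int]_(k, l) -> 'M[R]_(k, l)).
  move=> A B /matrixP AB; apply/matrixP => i j; apply/(@intr_inj R).
  by have := AB i j; rewrite !mxE.
have symT : T^T = T by apply: intr_mx_inj; rewrite -map_trmx ST.
have diagT i : T i i = 0 by rewrite mxE eqxx.
have pmT i j : i != j -> T i j = 1 \/ T i j = -1.
  by move=> /negbTE ij; rewrite mxE ij; case: ifP; [left|right].
have natE k : map_mx intr (k%:R%:M : 'M[int]_n) = k%:R%:M :> 'M[R]_n.
  by rewrite map_scalar_mx /= rmorph_nat.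
have [||x [y [c [c1 [pmx pmy] [Tx Ty] yx TT]]]] :=
  integer_extension symT diagT pmT even_n n3.
- apply: intr_mx_inj; rewrite map_mxZ map_mxM map_mxB map_mxM natE ST sqrM /=.
  by congr (_ *: _); rewrite rmorph_nat.
- by apply/eqP; rewrite -(intr_eq0 R) -trace_map_mx !map_mxM ST tr3.
have pmR (z : int) : z = 1 \/ z = -1 -> z%:~R = 1 :> R \/ z%:~R = -1 :> R.
  by case=> ->; [left|right; rewrite rmorphN1].
have [] := @border_conference R n S (map_mx intr x) (map_mx intr y) c%:~R hS.
- exact: pmR.
- by move=> i; rewrite mxE; apply: pmR.
- by move=> i; rewrite mxE; apply: pmR.
- by rewrite -ST -map_mxM Tx map_mxZ.
- by rewrite -ST -map_mxM Ty map_mxZ.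
- by rewrite map_trmx -map_mxM yx map_mx0.
- by rewrite -ST !map_trmx -!map_mxM -!map_mxD TT natE.
set C := border _ _ _ => symC confC.
by exists C, ord0, ord0; split=> //; rewrite !delete_border.
Qed.
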